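(* Let $n,k$ be positive integers. Suppose that $\mathcal{C}$ is a $3$-graph consisting of vertex-disjoint loose cycles $C_{n_1}, C_{n_2}, \ldots, C_{n_r}$ with $\sum_{i=1}^{r}n_i=n$, and that $k$ is the number of these loose cycles that have odd length. Then there exists a $3$-graph $\mathcal{H}$ with $n$ vertices and minimum codegree $\left\lfloor\frac{n+2k}{4}\right\rfloor-1$ that does not contain $\mathcal{C}$ as a spanning subhypergraph.
   Context: A $3$-graph (3-uniform hypergraph) $\mathcal{H}$ consists of a finite vertex set $V$ and an edge set $E\subseteq\binom{V}{3}$. Its minimum codegree is $\delta_2(\mathcal{H})=\min_{\{u,v\}\in\binom{V}{2}}|\{w\in V:\{u,v,w\}\in E\}|$. A loose cycle $C_t$ is a $3$-graph on $t$ vertices whose vertices can be ordered cyclically such that every hyperedge consists of three consecutive vertices and any two consecutive hyperedges share exactly one vertex. All loose cycles considered have $t\geq 6$ (and $t$ is necessarily even); equivalently, $C_t$ is obtained from a graph cycle with $t/2\ge 3$ edges by adding to each edge one new vertex, all new vertices being distinct. The length of $C_t$ is its number of hyperedges, i.e. $t/2$; so $C_{t}$ has odd length iff $t/2$ is odd. ''$\mathcal{H}$ contains $\mathcal{C}$ as a spanning subhypergraph'' means that $\mathcal{H}$ and $\mathcal{C}$ have the same number of vertices and there is an injective map $V(\mathcal{C})\to V(\mathcal{H})$ sending hyperedges to hyperedges. *)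

(* Defs.v *)
From HB Require Import structures.
From mathcomp Require Import all_boot.

Set Implicit Arguments.
Unset Strict Implicit.
Unset Printing Implicit Defensive.

Record three_graph (V : finType) := ThreeGraph {
  edges : {set {set V}};
  edges_card3 : {in edges, forall e : {set V}, #|e| = 3}
}.

(* A vertex w already in p never counts, since then w |: p = p has only two
   elements and is not an edge. *)
Definition codegree (V : finType) (H : three_graph V) (p : {set V}) : nat :=
  #|[set w : V | w |: p \in edges H]|.

(* A codegree is at most #|V| - 2 when p has two elements, so the default
   value #|V| is only returned when V has no pair of vertices at all. *)
Definition min_codegree (V : finType) (H : three_graph V) : nat :=
  \big[minn/#|V|]_(p : {set V} | #|p| == 2) codegree H p.

(* (X, E) is a copy of C_t inside the vertex type V: f lists X cyclically
   (ordS is the cyclic successor on 'I_t) and the edges are the triples of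
   consecutive vertices starting at even positions. The even positions carry
   the vertices of the underlying graph cycle with t/2 edges, and each odd
   position the new vertex added to one of these edges. *)
Definition is_loose_cycle (V : finType) (t : nat)
    (X : {set V}) (E : {set {set V}}) : Prop :=
  [/\ 6 <= t, ~~ odd t &
      exists f : 'I_t -> V,
        [/\ injective f,
            X = [set f i | i : 'I_t] &
            E = [set [set f i; f (ordS i); f (ordS (ordS i))]
                | i : 'I_t & ~~ odd i]]].

Definition consists_of_disjoint_loose_cycles (W : finType)
    (C : three_graph W) (r : nat) (ns : 'I_r -> nat) : Prop :=
  exists (X : 'I_r -> {set W}) (E : 'I_r -> {set {set W}}),
    [/\ forall i, is_loose_cycle (ns i) (X i) (E i),
        forall i j, i != j -> [disjoint X i & X j],
        \bigcup_i X i = [set: W] &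
        \bigcup_i E i = edges C].

(* The length of C_t is its number of edges, t/2. *)
Definition num_odd_cycles (r : nat) (ns : 'I_r -> nat) : nat :=
  #|[set i : 'I_r | odd (ns i)./2]|.

Definition contains_spanning (V W : finType)
    (H : three_graph V) (C : three_graph W) : Prop :=
  #|V| = #|W| /\
  exists g : W -> V,
    injective g /\ forall e : {set W}, e \in edges C -> g @: e \in edges H.

(* Main.v *)
Require Import Defs.
From HB Require Import structures.
From mathcomp Require Import all_boot order zify.

Set Implicit Arguments.
Unset Strict Implicit.
Unset Printing Implicit Defensive.

(** Fix a set A of (n + 2k)/4 - 1 vertices and let the edges be all triples that
    meet A: a pair outside A has codegree #|A| and any other pair codegree
    n - 2. A copy of C would make A a vertex cover of C. But a vertex of a loose
    cycle lies on at most two of its edges, so covering a cycle with m edges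
    takes at least ceil(m/2) vertices, and these numbers add up to
    (n + 2k)/4. *)

Lemma min_codegree_eq (V : finType) (H : three_graph V) (d : nat)
    (p : {set V}) :
  #|p| = 2 -> codegree H p = d ->
  (forall q : {set V}, #|q| = 2 -> d <= codegree H q) ->
  min_codegree H = d.
Proof.
move=> p2 pd d_le; rewrite /min_codegree -minEnat.
apply/eqP; rewrite eqn_leq; apply/andP; split.
  rewrite -pd -leEnat; apply: Order.TotalTheory.bigmin_le_cond.
  exact/eqP.
rewrite -leEnat; apply/Order.TotalTheory.bigmin_geP; split => [|q /eqP q2].
  (* The default value [#|V|] of the minimum is also at least [d], because [d] counts a set of
     vertices. *)
  by rewrite leEnat -pd max_card.
exact: d_le.
Qed.

Section Meeting.
Variables (V : finType) (A : {set V}).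

Definition meeting_triples : {set {set V}} :=
  [set e : {set V} | (#|e| == 3) && (e :&: A != set0)].

Lemma meeting_triples_card3 :
  {in meeting_triples, forall e : {set V}, #|e| = 3}.
Proof. by move=> e; rewrite inE => /andP[/eqP]. Qed.

Definition meeting_graph : three_graph V := ThreeGraph meeting_triples_card3.

Lemma codegree_meeting_graph (p : {set V}) : #|p| = 2 ->
  codegree meeting_graph p = if p :&: A == set0 then #|A| else #|V| - 2.
Proof.
move=> p2; rewrite /codegree /=.
case: ifPn => [pA0 | pA].
  apply: eq_card => w; rewrite !inE cardsU1 p2 setIUl (eqP pA0) setU0.
  apply/andP/idP => [[_ /set0Pn[x]] | wA].
    by rewrite !inE => /andP[/eqP->].
  split; last by apply/set0Pn; exists w; rewrite !inE eqxx.
  have -> // : w \notin p.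
  by apply/negP => wp; move/eqP/setP/(_ w): pA0; rewrite !inE wp wA.
(* [#|V| - 2] becomes the size of the complement of [p]: once [p] meets [A], every vertex outside
   [p] completes it to an edge. *)
rewrite -p2 -cardsT -(cardsDS (subsetT p)).
apply: eq_card => w; rewrite !inE andbT cardsU1 p2.
have -> : (w |: p) :&: A != set0.
  have /set0Pn[x] := pA; rewrite inE => /andP[xp xA].
  by apply/set0Pn; exists x; rewrite !inE xp xA orbT.
by case: (w \in p).
Qed.

(** The bound leaves two vertices outside [A], whose pair attains [#|A|], and keeps the other value
    [#|V| - 2] from being smaller. *)
Lemma min_codegree_meeting_graph : #|A| + 2 <= #|V| ->
  min_codegree meeting_graph = #|A|.
Proof.
move=> leAV.
have /card_gt1P[x [y [xA yA neq_xy]]] : 1 < #|~: A|.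
  by have := cardsC A; lia.
apply: (@min_codegree_eq _ _ _ [set x; y]) => [||q q2].
- by rewrite cards2 neq_xy.
- rewrite codegree_meeting_graph ?cards2 ?neq_xy // ifT //.
  rewrite setI_eq0 disjoints_subset; apply/subsetP => z.
  by rewrite !inE => /orP[] /eqP->; move: xA yA; rewrite !inE.
by rewrite codegree_meeting_graph //; case: ifP => // _; lia.
Qed.

End Meeting.

(** Only the wrap-around from [t - 1] to 0 needs the evenness of [t]. *)
Lemma odd_ordS (t : nat) (i : 'I_t) : ~~ odd t -> odd (ordS i) = ~~ odd i.
Proof.
move=> t_even; rewrite /=.
have [lt_it|] := ltnP i.+1 t; first by rewrite modn_small.
move=> le_ti; have it : i.+1 = t by apply/eqP; rewrite eqn_leq ltn_ord.
by rewrite {1}it modnn -oddS it (negbTE t_even).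
Qed.

(** Edges are indexed by their even starting positions [Ev], and [S] is pulled back to a set [T] of
    positions. The edge starting at [i] is hit at [i], at its odd successor, or at the next even
    position, so at most [2 * #|T|] edges are hit. *)
Lemma loose_cycle_cover (V : finType) (t : nat) (X : {set V})
    (E : {set {set V}}) (S : {set V}) :
  is_loose_cycle t X E -> (forall e, e \in E -> e :&: S != set0) ->
  uphalf t./2 <= #|S :&: X|.
Proof.
move=> [_ t_even [f [f_inj -> ->]]] S_cover.
pose T := f @^-1: S.
have cardT : #|T| <= #|S :&: [set f i | i : 'I_t]|.
  rewrite -(card_imset _ f_inj) subset_leq_card //.
  apply/subsetP => _ /imsetP[i iT ->].
  by rewrite inE imset_f // andbT; rewrite inE in iT.
pose Ev := [set i : 'I_t | ~~ odd i].
have cardS (B : {set 'I_t}) : #|(@ordS t) @^-1: B| = #|B|.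
  exact: on_card_preimset (onW_bij _ (ordS_bij t)).
(* The successor is a bijection exchanging even and odd positions, so each class is half of all
   positions. *)
have cardEv : #|Ev|.*2 = t.
  rewrite -addnn -[RHS]card_ord -(cardsC Ev); congr (_ + _).
  rewrite -cardS; apply: eq_card => i.
  by rewrite !inE odd_ordS.
(* Even positions lie on two edges, odd ones on a single edge. *)
have sub : Ev \subset (T :&: Ev) :|: (@ordS t) @^-1:
    ((T :\: Ev) :|: (@ordS t) @^-1: (T :&: Ev)).
  apply/subsetP => i; rewrite inE => i_even.
  have /S_cover/set0Pn[x] :
      [set f i; f (ordS i); f (ordS (ordS i))] \in
        [set [set f i; f (ordS i); f (ordS (ordS i))] | i : 'I_t & ~~ odd i].
    by apply/imsetP; exists i; rewrite ?inE.
  rewrite !inE -orbA => /andP[/or3P[] /eqP-> xS];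
    by rewrite ?odd_ordS // ?negbK xS ?i_even ?orbT ?andbT.
have leEv : #|Ev| <= #|T :&: Ev| + (#|T :\: Ev| + #|T :&: Ev|).
  apply: leq_trans (subset_leq_card sub) _.
  apply: leq_trans (leq_card_setU _ _) _; rewrite leq_add2l cardS.
  by apply: leq_trans (leq_card_setU _ _) _; rewrite cardS.
have -> : t./2 = #|Ev| by rewrite -[in LHS]cardEv doubleK.
apply: leq_trans cardT; rewrite leq_uphalf_double.
apply: leq_trans leEv _; rewrite -(cardsID Ev T); lia.
Qed.

Lemma num_odd_cyclesE (r : nat) (ns : 'I_r -> nat) :
  num_odd_cycles ns = \sum_(i < r) odd (ns i)./2.
Proof. by rewrite /num_odd_cycles cardsE -sum1_card big_mkcond. Qed.

Section CycleUnion.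
Variables (W : finType) (C : three_graph W) (r : nat) (ns : 'I_r -> nat).
Hypothesis C_cycles : consists_of_disjoint_loose_cycles C ns.

(** The traces of [S] on the cycles are disjoint, so the bounds for single cycles add up. *)
Lemma cover_loose_cycles (S : {set W}) :
  (forall e, e \in edges C -> e :&: S != set0) ->
  \sum_(i < r) uphalf (ns i)./2 <= #|S|.
Proof.
move=> S_cover; have [X [E [cyc disj _ edgesE]]] := C_cycles.
have disjS i j : i != j -> [disjoint S :&: X i & S :&: X j].
  move=> /disj; apply: disjointW; apply/subsetP => x; rewrite inE;
  by case/andP.
apply: (@leq_trans (\sum_i #|S :&: X i|)).
  apply: leq_sum => i _; apply: (loose_cycle_cover (cyc i)) => e eE.
  by apply: S_cover; rewrite -edgesE; apply/bigcupP; exists i.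
under eq_bigr do rewrite -sum1_card.
rewrite -partition_disjoint_bigcup // sum1_card subset_leq_card //.
by apply/bigcupsP => i _; apply: subsetIl.
Qed.

(** A cycle with m edges has 2m vertices, and four times the upper half of m is 2m, plus 2 if m is
    odd. Hence 4 divides [n + 2 * k] exactly. *)
Lemma sum_uphalf_loose_cycles :
  4 * (\sum_(i < r) uphalf (ns i)./2) =
    \sum_(i < r) ns i + 2 * num_odd_cycles ns.
Proof.
have [X [E [cyc _ _ _]]] := C_cycles.
rewrite num_odd_cyclesE !big_distrr -big_split /=.
apply: eq_bigr => i _; have [_ ni_even _] := cyc i.
by rewrite uphalf_half; lia.
Qed.

(** Every cycle has at least six vertices. This keeps the covering number small enough for [A] to
    leave two vertices free. *)
Lemma num_odd_cycles_le : 6 * num_odd_cycles ns <= \sum_(i < r) ns i.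
Proof.
have [X [E [cyc _ _ _]]] := C_cycles.
rewrite num_odd_cyclesE big_distrr /=.
by apply: leq_sum => i _; have [? _ _] := cyc i; case: odd.
Qed.

End CycleUnion.

Theorem proposition1p5 (n k : nat) (n_gt0 : 0 < n) (k_gt0 : 0 < k)
    (r : nat) (ns : 'I_r -> nat) (W : finType) (C : three_graph W)
    (C_cycles : consists_of_disjoint_loose_cycles C ns)
    (sum_ns : \sum_(i < r) ns i = n)
    (k_odd : num_odd_cycles ns = k) :
  exists (V : finType) (H : three_graph V),
    [/\ #|V| = n,
        min_codegree H = (n + 2 * k) %/ 4 - 1 &
        ~ contains_spanning H C].
Proof.
have := sum_uphalf_loose_cycles C_cycles.
have := num_odd_cycles_le C_cycles.
rewrite sum_ns k_odd; set c := \sum_(i < r) _ => le6k c4.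
have -> : (n + 2 * k) %/ 4 - 1 = c.-1 by lia.
have [A cardA] : exists A : {set 'I_n}, #|A| = c.-1.
  have /card_geqP[s [s_uniq <- _]] : c.-1 <= #|'I_n| by rewrite card_ord; lia.
  by exists [set i in s]; rewrite cardsE; apply/card_uniqP.
exists 'I_n, (meeting_graph A); split; first exact: card_ord.
  by rewrite min_codegree_meeting_graph cardA // card_ord; lia.
move=> [_ [g [g_inj g_edges]]].
(* Images of edges of [C] meet [A], so the preimage of [A] covers [C]. *)
have : c <= #|g @^-1: A|.
  apply: (cover_loose_cycles C_cycles) => e /g_edges.
  rewrite inE => /andP[_ /set0Pn[_ /setIP[/imsetP[x xe ->] gxA]]].
  by apply/set0Pn; exists x; rewrite !inE xe.
have : #|g @^-1: A| <= #|A|.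
  rewrite -(card_imset _ g_inj) subset_leq_card //.
  by apply/subsetP => _ /imsetP[x xA ->]; rewrite inE in xA.
(* [c <= c.-1] is absurd since [n_gt0] and [c4] make [c] positive. *)
rewrite cardA; lia.
Qed.
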